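(* Let $\Delta$ be a finite block square graph, with corresponding vertex subsets $\pi_1,\pi_2,\pi_3,\pi_4$. Then there exists a finite group $G$ such that $\Delta(G)=\Delta$ (as graphs, up to isomorphism) if and only if $\pi_i$ is a clique of $\Delta$ for each $1\leq i\leq 4$, and all the vertices in $\pi_1\cup\pi_4$ are adjacent to all the vertices in $\pi_2\cup\pi_3$.
   Context: Prime graph on class sizes: for a finite group $G$, $\Delta(G)$ is the simple undirected graph whose vertices are the prime numbers dividing some conjugacy class size of $G$, and in which two distinct vertices $p,q$ are adjacent if and only if $pq$ divides some conjugacy class size of $G$. Graphs are simple and undirected. A set of vertices is a clique if it induces a complete subgraph (a single vertex is a clique). Block square: a graph is a block square if its vertex set can be written as a union of four pairwise disjoint, non-empty subsets $\pi_1,\pi_2,\pi_3,\pi_4$ such that no vertex in $\pi_1$ is adjacent to any vertex in $\pi_4$, no vertex in $\pi_2$ is adjacent to any vertex in $\pi_3$, and there exist vertices in both $\pi_1$ and $\pi_4$ that are adjacent to vertices in $\pi_2$ and in $\pi_3$; that is, for each $i\in\{1,4\}$ and each $j\in\{2,3\}$ there is at least one edge between a vertex of $\pi_i$ and a vertex of $\pi_j$. In the claim, $\pi_1,\pi_2,\pi_3,\pi_4$ is a fixed such decomposition of the vertex set of $\Delta$. *)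

(* Defs.v *)
From mathcomp Require Import all_boot all_fingroup.
Set Implicit Arguments.
Unset Strict Implicit.
Unset Printing Implicit Defensive.

(* A simple graph on a vertex type T is given by its adjacency relation,
   a symmetric and irreflexive [e : rel T]. *)

Definition graph_iso (T U : Type) (e : rel T) (e' : rel U) : Prop :=
  exists2 f : T -> U, bijective f & forall x y, e' (f x) (f y) = e x y.

Definition clique (T : finType) (e : rel T) (A : {set T}) : Prop :=
  {in A &, forall x y, x != y -> e x y}.

Definition all_adjacent (T : finType) (e : rel T) (A B : {set T}) : Prop :=
  {in A & B, forall x y, e x y}.

Definition none_adjacent (T : finType) (e : rel T) (A B : {set T}) : Prop :=
  {in A & B, forall x y, ~~ e x y}.

Definition some_adjacent (T : finType) (e : rel T) (A B : {set T}) : Prop :=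
  exists x y, [/\ x \in A, y \in B & e x y].

Record block_square (T : finType) (e : rel T) (pi1 pi2 pi3 pi4 : {set T}) : Prop :=
  BlockSquare {
    bs_cover : pi1 :|: pi2 :|: pi3 :|: pi4 = [set: T];
    bs_nonempty : [/\ pi1 != set0, pi2 != set0, pi3 != set0 & pi4 != set0];
    bs_disjoint1 : [/\ [disjoint pi1 & pi2], [disjoint pi1 & pi3]
                     & [disjoint pi1 & pi4]];
    bs_disjoint2 : [/\ [disjoint pi2 & pi3], [disjoint pi2 & pi4]
                     & [disjoint pi3 & pi4]];
    bs_nonadj14 : none_adjacent e pi1 pi4;
    bs_nonadj23 : none_adjacent e pi2 pi3;
    bs_adj1 : some_adjacent e pi1 pi2 /\ some_adjacent e pi1 pi3;
    bs_adj4 : some_adjacent e pi4 pi2 /\ some_adjacent e pi4 pi3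
  }.

Definition divides_class_size (gT : finGroupType) (G : {group gT}) (n : nat) : bool :=
  [exists C in classes G, n %| #|C|].

Definition class_prime (gT : finGroupType) (G : {group gT}) (p : nat) : bool :=
  prime p && divides_class_size G p.

(* The prime graph on class sizes: vertex type and adjacency relation. *)
Definition class_graph_vertex (gT : finGroupType) (G : {group gT}) : Type :=
  {p : nat | class_prime G p}.

Definition class_graph (gT : finGroupType) (G : {group gT}) :
    rel (class_graph_vertex G) :=
  fun p q => (sval p != sval q) && divides_class_size G (sval p * sval q).

Lemma class_graph_sym (gT : finGroupType) (G : {group gT}) :
  symmetric (@class_graph gT G).
Proof. by move=> p q; rewrite /class_graph eq_sym mulnC. Qed.

Lemma class_graph_irr (gT : finGroupType) (G : {group gT}) :
  irreflexive (@class_graph gT G).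
Proof. by move=> p; rewrite /class_graph eqxx. Qed.

(* Main.v *)
Require Import Defs.
From HB Require Import structures.
From mathcomp Require Import all_boot all_order all_algebra.
From mathcomp Require Import all_fingroup all_solvable zify.
Set Implicit Arguments.
Unset Strict Implicit.
Unset Printing Implicit Defensive.

(** Write A, B, C, D for the sets of primes that label pi1, pi2, pi3, pi4, and
say that p divides x when p divides the size of the class of x in G.

Sufficiency.  For coprime n, m > 1 there is a Frobenius group with abelian
kernel K and cyclic complement of order n, such that K and m have the same prime
divisors; its class sizes are 1, n and #|K| ([frobenius_sizes]).  Two such groups, for the
products of primes over pi1 and pi4 and over pi2 and pi3, have a direct product
whose nontrivial class sizes have prime divisors pi_i, pi_j or the union of both,
for i = 1, 4 and j = 2, 3, and this is the required graph
([block_square_labelling]).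

Necessity.  A prime p does not divide x exactly when x is centralised by some
Sylow p-subgroup.  So if p and q are nonadjacent, G is covered by the conjugates
of C(P) and of C(Q), with P and Q Sylow.  Conjugates of two subgroups that both
differ from their normalisers are too few to cover a group
([covering_self_normalising]), hence N(P) = C(P) or N(Q) = C(Q), and by
Burnside's transfer theorem p or q does not divide #|G^`(1)|
([nonadjacent_der]).  Up to exchanging pi1 with pi4 and pi2 with pi3, no prime of
A or B divides #|G^`(1)|; then R, the largest normal subgroup of order prime to A
and B, is a Hall subgroup with abelian quotient.

An edge between pi1 and pi2 gives an x divided by primes of A and of B, hence by
none of C and D, so x centralises R.  Its R-part r is central in R and is not
centralised by the Sylow subgroups of some a in A and some b in B.  As r
normalises C_R(P) for these Sylow subgroups P, the covering argument inside R
leaves only the other alternative: every Sylow subgroup of R is central in its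
normaliser.  So R is abelian ([core_abelian]), and G is the semidirect product of
R with an abelian Hall subgroup H.

In such a group every element is conjugate to a product r * h of commuting r in R
and h in H, and a prime divides it exactly when the Sylow subgroup of H does not
centralise r, respectively that of R does not centralise h
([class_dvd_complement], [class_dvd_core]).  The four edges given by the block
square then produce one element divided by all the primes of A and B, and
likewise for A and C, D and B, D and C ([class_square_covered]); these four
elements give all the adjacencies. *)

(** * A Frobenius group with prescribed class sizes *)

Section FrobeniusLike.
Local Open Scope group_scope.
Variables (gT : finGroupType) (G K : {group gT}).
Hypotheses (sKG : K \subset G) (abK : abelian K).
Hypothesis commK : forall x y, x \in G -> y \in G -> [~ x, y] \in K.
Hypothesis regK : forall x, x \in G -> x \notin K -> 'C_K[x] = 1.

(** Outside 1, the centraliser of an element of the abelian kernel is the whole kernel. *)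
Lemma class_size_kernel x : x \in K -> x != 1 -> #|x ^: G| = #|G : K|.
Proof.
move=> Kx nt_x; rewrite -index_cent1; suff -> : 'C_G[x] = K by [].
apply/eqP; rewrite eqEsubset andbC {1}subsetI sKG -{1}cent_set1 sub_abelian_cent ?sub1set //=.
apply/subsetP=> y /setIP[Gy cxy]; apply: contraT => K'y.
suff : x \in 'C_K[y] by rewrite regK // inE (negPf nt_x).
by rewrite inE Kx cent1C.
Qed.

(** The class lies in the coset x * K because commutators lie in K, and it has at
least #|K| elements because the centraliser meets K trivially. *)
Lemma class_size_complement x : x \in G -> x \notin K -> #|x ^: G| = #|K|.
Proof.
move=> Gx K'x; apply/eqP; rewrite eqn_leq; apply/andP; split.
  rewrite -(card_lcoset K x); apply: subset_leq_card.
  apply/subsetP=> _ /imsetP[y Gy ->]; rewrite conjg_mulR mem_lcoset mulKg.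
  exact: commK.
have TI : K :&: 'C_G[x] = 1 by rewrite setIA (setIidPl sKG) regK.
rewrite -index_cent1 -(leq_pmul2l (cardG_gt0 'C_G[x])) Lagrange ?subsetIl //.
rewrite mulnC -TI_cardMg //; apply: subset_leq_card.
by rewrite mul_subG ?subsetIl.
Qed.
End FrobeniusLike.

Section Wreath.
Import GRing.Theory.
Local Open Scope ring_scope.
Variables n m : nat.

(** The wreath product of the cyclic groups of orders m and n; ['Z_n] acts on
functions by translating their argument. *)
Definition wreath : Type := ('Z_n * {ffun 'Z_n -> 'Z_m})%type.

HB.instance Definition _ := Finite.copy wreath ('Z_n * {ffun 'Z_n -> 'Z_m})%type.

Definition wreath_mul (u v : wreath) : wreath :=
  (u.1 + v.1, [ffun x => u.2 (x + v.1) + v.2 x]).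
Definition wreath_one : wreath := (0, 0).
Definition wreath_inv (u : wreath) : wreath :=
  (- u.1, [ffun x => - u.2 (x - u.1)]).

Fact wreath_mulA : associative wreath_mul.
Proof.
move=> [i f] [j g] [k h]; congr pair; rewrite /= ?addrA //.
by apply/ffunP=> x; rewrite !ffunE /= !addrA (addrAC x j k).
Qed.

Fact wreath_mul1 : left_id wreath_one wreath_mul.
Proof.
by move=> [i f]; congr pair; rewrite /= ?add0r //; apply/ffunP=> x; rewrite !ffunE add0r.
Qed.

Fact wreath_mulV : left_inverse wreath_one wreath_inv wreath_mul.
Proof.
move=> [i f]; congr pair; rewrite /= ?addNr //.
by apply/ffunP=> x; rewrite !ffunE /= addrK addNr.
Qed.

HB.instance Definition _ := Finite_isGroup.Build wreath wreath_mulA wreath_mul1 wreath_mulV.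

(** The functions killed by the norm element of every nontrivial cyclic subgroup of
['Z_n].  The sum over j in ['Z_n] runs through each coset of the subgroup generated
by h several times, which is harmless as n is invertible modulo m.  A function in this
set that is invariant under some h != 0 vanishes, which makes the action regular. *)
Definition null_norms : {set {ffun 'Z_n -> 'Z_m}} :=
  [set f : {ffun 'Z_n -> 'Z_m} | [forall h : 'Z_n, (h != 0) ==>
    [forall x : 'Z_n, \sum_(j : 'Z_n) f (x + h * j) == 0]]].

Lemma null_normsP (f : {ffun 'Z_n -> 'Z_m}) :
  reflect (forall h : 'Z_n, h != 0 -> forall x : 'Z_n, \sum_(j : 'Z_n) f (x + h * j) = 0)
          (f \in null_norms).
Proof.
rewrite inE; apply: (iffP forallP) => [Nf h h0 x | Nf h].
  by have /implyP/(_ h0)/forallP/(_ x)/eqP := Nf h.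
by apply/implyP=> h0; apply/forallP=> x; rewrite Nf.
Qed.

Definition frob_set : {set wreath} := [set u | u.2 \in null_norms].
Definition frob_ker_set : {set wreath} := [set u | (u.1 == 0) && (u.2 \in null_norms)].

Lemma null_norms0 : 0 \in null_norms.
Proof. by apply/null_normsP=> h _ x; rewrite big1 // => j _; rewrite ffunE. Qed.

Lemma null_norms_mul f g i : f \in null_norms -> g \in null_norms ->
  [ffun x => f (x + i) + g x] \in null_norms.
Proof.
move=> /null_normsP Nf /null_normsP Ng; apply/null_normsP=> h h0 x.
under eq_bigr do rewrite ffunE addrAC.
by rewrite big_split /= Nf // Ng // addr0.
Qed.

Lemma mem_frob (u : wreath) : (u \in frob_set) = (u.2 \in null_norms).
Proof. exact: in_set. Qed.

Lemma mem_frob_ker (u : wreath) :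
  (u \in frob_ker_set) = (u.1 == 0) && (u \in frob_set).
Proof. by rewrite mem_frob; exact: in_set. Qed.

Fact frob_group_set : group_set frob_set.
Proof.
apply/group_setP; split=> [|u v]; first by rewrite mem_frob null_norms0.
by rewrite !mem_frob => Nu Nv; exact: (null_norms_mul v.1 Nu Nv).
Qed.
Canonical frob_group := group frob_group_set.

Fact frob_ker_group_set : group_set frob_ker_set.
Proof.
apply/group_setP; split=> [|u v]; first by rewrite mem_frob_ker eqxx group1.
rewrite !mem_frob_ker => /andP[/eqP u0 Nu] /andP[/eqP v0 Nv].
by rewrite groupM // andbT /= u0 v0 addr0.
Qed.
Canonical frob_ker := group frob_ker_group_set.

Lemma wreath_fstM (u v : wreath) : (u * v)%g.1 = u.1 + v.1. Proof. by []. Qed.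
Lemma wreath_fstV (u : wreath) : (u^-1)%g.1 = - u.1. Proof. by []. Qed.
Lemma wreath_sndM (u v : wreath) x : (u * v)%g.2 x = u.2 (x + v.1) + v.2 x.
Proof. exact: ffunE. Qed.

Lemma frob_ker_sub : frob_ker \subset frob_group.
Proof. by apply/subsetP=> u; rewrite mem_frob_ker => /andP[]. Qed.

Lemma frob_ker_abelian : abelian frob_ker.
Proof.
apply/centsP=> u /[!mem_frob_ker] /andP[/eqP u0 _] v /[!mem_frob_ker] /andP[/eqP v0 _].
by congr pair; [rewrite addrC | apply/ffunP=> x; rewrite !ffunE u0 v0 !addr0 addrC].
Qed.

Lemma frob_comm u v : u \in frob_group -> v \in frob_group -> [~ u, v]%g \in frob_ker.
Proof.
move=> Gu Gv; rewrite mem_frob_ker groupR // andbT.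
rewrite /commg /conjg !wreath_fstM !wreath_fstV.
by rewrite [u.1 + _]addrC addKr addNr.
Qed.

Hypotheses (n_gt1 : (1 < n)%N) (m_gt1 : (1 < m)%N) (co_nm : coprime n m).

(** If v commutes with u then its function is invariant under u.1, so its norm
along u.1 is n times the function; the norm is 0 and n is invertible. *)
Lemma frob_regular u : u \in frob_group -> u \notin frob_ker -> ('C_frob_ker[u] = 1)%g.
Proof.
move=> Gu; rewrite mem_frob_ker Gu andbT => u0; apply/trivgP/subsetP=> v.
rewrite in_setI mem_frob_ker mem_frob => /andP[/andP[/eqP v0 /null_normsP Nv]].
move/cent1P=> cvu; have invu x : v.2 (x + u.1) = v.2 x.
  have := congr1 (fun w : wreath => w.2 x) cvu.
  by rewrite !wreath_sndM v0 addr0 addrC => /addrI.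
have invX x (j : nat) : v.2 (x + u.1 *+ j) = v.2 x.
  by elim: j => [|j IH]; rewrite ?addr0 // mulrSr addrA invu.
suff v20 : v.2 = 0 by rewrite inE [v]surjective_pairing v0 v20.
apply/ffunP=> x; rewrite ffunE.
have := Nv _ u0 x; rewrite (eq_bigr (fun=> v.2 x)) => [|j _]; last first.
  by rewrite -[j in u.1 * j]natr_Zp mulr_natr invX.
rewrite sumr_const card_ord => vn.
have Un : ((Zp_trunc n).+2%:R : 'Z_m) \is a GRing.unit.
  by rewrite unitZpE // coprime_sym Zp_cast.
by apply: (mulIr Un); rewrite mul0r mulr_natr.
Qed.

Lemma card_frob_index : #|frob_group : frob_ker|%g = n.
Proof.
have cardN (A : {set 'Z_n}) : #|[set u : wreath | (u.1 \in A) && (u.2 \in null_norms)]| =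
    (#|A| * #|null_norms|)%N.
  rewrite -cardsX; apply: eq_card => -[i f].
  by rewrite in_set.
have cardG : #|frob_group| = (n * #|null_norms|)%N.
  have cZ : #|[set: 'Z_n]| = n by rewrite cardsT card_ord Zp_cast.
  rewrite -[X in (X * _)%N]cZ -cardN.
  by apply: eq_card => u; rewrite mem_frob [RHS]in_set in_setT.
have cardK : #|frob_ker| = #|null_norms|.
  have := cardN [set 0]; rewrite cards1 mul1n => <-.
  by apply: eq_card => u; rewrite mem_frob_ker [RHS]in_set in_set1 mem_frob.
by rewrite -divgS ?frob_ker_sub // cardG cardK mulnK // -cardK cardG_gt0.
Qed.

Lemma wreath_expg0 (u : wreath) k : u.1 = 0 -> (u ^+ k)%g = (0, u.2 *+ k) :> wreath.
Proof.
move=> u0; elim: k => [|k IH]; first by rewrite expg0 mulr0n.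
rewrite expgSr IH mulrSr; congr pair; rewrite /= ?u0 ?addr0 //.
by apply/ffunP=> x; rewrite !ffunE addr0.
Qed.

Lemma order_frob_ker u : u \in frob_ker -> (#[u]%g %| m)%N.
Proof.
rewrite mem_frob_ker => /andP[/eqP u0 _]; rewrite order_dvdn wreath_expg0 //.
apply/eqP; congr pair; apply/ffunP=> x; rewrite ffunMnE ffunE.
by rewrite -mulr_natr (_ : m%:R = 0) ?mulr0 //; apply/val_inj; rewrite /= val_Zp_nat // modnn.
Qed.

Lemma frob_ker_dvd f : f \in null_norms -> f 0 = 1 -> (m %| #|frob_ker|)%N.
Proof.
move=> Nf f0; pose u : wreath := (0, f).
have Ku : u \in frob_ker by rewrite mem_frob_ker eqxx mem_frob.
apply: dvdn_trans (order_dvdG Ku); have := expg_order u.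
rewrite wreath_expg0 // => /(congr1 (fun w : wreath => w.2 0)).
rewrite ffunMnE f0 ffunE => /(congr1 val); rewrite /= val_Zp_nat // => o0.
by rewrite /dvdn o0.
Qed.

(** The product of the elements 1 - [n / p] of the group ring of ['Z_n], for p in s.
Each factor kills the norm elements of the subgroups that contain n / p. *)
Fixpoint alternating (s : seq nat) : {ffun 'Z_n -> 'Z_m} :=
  if s is p :: s' then
    [ffun x => alternating s' x - alternating s' (x + (n %/ p)%:R)]
  else [ffun x => (x == 0)%:R].

Lemma val_Zp_addn (x : 'Z_n) c : nat_of_ord (x + c%:R) = ((x + c) %% n)%N.
Proof.
by rewrite /= val_Zp_nat //; move: (nat_of_ord x) => y; rewrite Zp_cast // modnDmr.
Qed.

(** All the translations n / p with p in s preserve divisibility by the q-part of n. *)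
Lemma alternating_support s q x : all prime s -> all (dvdn^~ n) s -> prime q ->
  q \notin s -> alternating s x != 0 -> (n`_q %| x)%N.
Proof.
elim: s x => [|p s IH] x /=.
  by rewrite ffunE; case: (x =P 0) => [-> | _]; rewrite ?dvdn0 ?eqxx.
case/andP=> pr_p pr_s /andP[p_n s_n] pr_q; rewrite in_cons => /norP[neq_qp qs] nz.
have q_c : (n`_q %| n %/ p)%N.
  rewrite -(@Gauss_dvdr _ p) ?[(p * _)%N]mulnC ?divnK ?dvdn_part //.
  apply: (pnat_coprime (part_pnat q n)); rewrite (pnatE _ pr_p) inE.
  by rewrite /= inE eq_sym.
have [/eqP Fx|Fx] := boolP (alternating s x == 0); last exact: (IH x pr_s s_n pr_q qs Fx).
move: nz; rewrite ffunE Fx sub0r oppr_eq0 => /(IH _ pr_s s_n pr_q qs).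
rewrite val_Zp_addn /dvdn modn_dvdm ?dvdn_part // -!/(dvdn _ _).
by rewrite dvdn_addl.
Qed.

(** The contribution of the factor for p at 0 is the value at n / p, which is not
divisible by the p-part of n. *)
Lemma alternating0 s : uniq s -> all prime s -> all (dvdn^~ n) s -> alternating s 0 = 1.
Proof.
elim: s => [|p s IH] /=; first by rewrite ffunE eqxx.
case/andP=> ps uniq_s /andP[pr_p pr_s] /andP[p_n s_n].
have n_gt0 : (0 < n)%N by exact: ltnW.
rewrite ffunE IH // add0r; suff /eqP-> : alternating s (n %/ p)%:R == 0 by rewrite subr0.
apply: contraT => /(alternating_support pr_s s_n pr_p ps).
rewrite /= val_Zp_nat // modn_small ?ltn_Pdiv ?prime_gt1 // => dv.
have : (p * n`_p %| n %/ p * p)%N by rewrite mulnC dvdn_mul.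
rewrite divnK //.
by rewrite p_part -expnS pfactor_dvdn // ltnn.
Qed.

(** The factor for p is a difference of two translates by a multiple of h, whose sums
along h agree. *)
Lemma alternating_sum s p h k x : p \in s -> h * k = (n %/ p)%:R ->
  \sum_(j : 'Z_n) alternating s (x + h * j) = 0.
Proof.
move=> ps hk; elim: s x ps => [|q s IH] x //=; rewrite in_cons => ps.
under eq_bigr do rewrite ffunE.
rewrite sumrB; have [eq_pq | neq_pq] := eqVneq p q.
  rewrite -eq_pq -hk; apply/eqP; rewrite subr_eq0; apply/eqP.
  rewrite [LHS](reindex_inj (addIr k)); apply: eq_bigr => j _.
  by rewrite mulrDr addrA.
move: ps; rewrite (negPf neq_pq) /= => ps; rewrite IH // sub0r.
apply/eqP; rewrite oppr_eq0; apply/eqP; rewrite -[RHS](IH (x + (n %/ q)%:R) ps).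
by apply: eq_bigr => j _; rewrite addrAC.
Qed.

(** The subgroup generated by h contains an element of prime order p, so it contains
the subgroup of order p. *)
Lemma prime_multiple (h : 'Z_n) : h != 0 ->
  exists p k, [/\ p \in primes n & h * k = (n %/ p)%:R].
Proof.
move=> h0; have a_gt0 : (0 < h)%N by rewrite lt0n.
have n_gt0 : (0 < n)%N by exact: ltnW.
have a_lt : (h < n)%N by rewrite -[X in (_ < X)%N](Zp_cast n_gt1) ltn_ord.
pose g := gcdn h n; have g_gt0 : (0 < g)%N by rewrite gcdn_gt0 a_gt0.
have g_n : (g %| n)%N := dvdn_gcdr _ _.
have ng : (1 < n %/ g)%N.
  by rewrite ltn_divRL // mul1n (leq_ltn_trans _ a_lt) // dvdn_leq // dvdn_gcdl.
pose p := pdiv (n %/ g); have pr_p : prime p := pdiv_prime ng.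
have p_ng : (p %| n %/ g)%N := pdiv_dvd _.
have [u v uv _] := egcdnP n a_gt0.
(* Modulo n, h * u is g = gcd (h, n), which divides n / p. *)
exists p, (u * ((n %/ g) %/ p))%:R; split.
  have ng_n : (n %/ g %| n)%N by apply/dvdnP; exists g; rewrite mulnC divnK.
  by rewrite mem_primes pr_p n_gt0 (dvdn_trans p_ng ng_n).
have -> : (n %/ p = g * (n %/ g %/ p))%N.
  by rewrite muln_divA // mulnC divnK.
rewrite -{1}[h]natr_Zp -natrM mulnA mulnC [(h * u)%N]mulnC uv.
rewrite mulnC mulnDl natrD -mulnA [(n * _)%N]mulnC mulnA natrM.
by rewrite (_ : n%:R = 0) ?mulr0 ?add0r //; apply/val_inj; rewrite /= val_Zp_nat // modnn.
Qed.

Lemma m_dvd_frob_ker : (m %| #|frob_ker|)%N.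
Proof.
have n_gt0 : (0 < n)%N by exact: ltnW.
have pr_s : all prime (primes n) by apply/allP=> p; rewrite mem_primes => /andP[].
have s_n : all (dvdn^~ n) (primes n) by apply/allP=> p; rewrite mem_primes => /and3P[].
apply: (@frob_ker_dvd (alternating (primes n))); last first.
  by rewrite alternating0 ?primes_uniq.
apply/null_normsP=> h /prime_multiple[p [k [ps hk]]] x; exact: alternating_sum ps hk.
Qed.
End Wreath.

(** The kernel is a group of functions from ['Z_n] to ['Z_m] on which ['Z_n] acts
regularly by translation.  It contains an element of order m because one of the functions
takes the value 1 at 0. *)
Lemma frobenius_sizes n m : 1 < n -> 1 < m -> coprime n m ->
  exists (gT : finGroupType) (G : {group gT}) (k : nat),
  [/\ forall p, prime p -> (p %| k) = (p %| m),
      forall x, x \in G -> #|x ^: G|%g \in [:: 1; n; k],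
      exists2 x, x \in G & #|x ^: G|%g = n
    & exists2 x, x \in G & #|x ^: G|%g = k].
Proof.
move=> n_gt1 m_gt1 co_nm.
pose G := frob_group n m; pose K := frob_ker n m.
have sKG : K \subset G := frob_ker_sub n m.
have abK : abelian K := frob_ker_abelian n m.
have comm := @frob_comm n m; have reg := @frob_regular n m n_gt1 m_gt1 co_nm.
have idx : #|G : K|%g = n := card_frob_index m n_gt1.
have mK : m %| #|K| := m_dvd_frob_ker n_gt1 m_gt1.
have K_gt1 : 1 < #|K| by apply: leq_trans (dvdn_leq _ mK).
have sizeK x : x \in K -> x != 1%g -> #|x ^: G|%g = n.
  by move=> Kx nt_x; rewrite (class_size_kernel sKG abK reg).
have sizeC x : x \in G -> x \notin K -> #|x ^: G|%g = #|K|.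
  exact: (class_size_complement sKG comm reg).
exists (wreath n m), G, #|K|; split.
- move=> p pr_p; apply/idP/idP=> [pK | /dvdn_trans-> //].
  have [u Ku <-] := Cauchy pr_p pK; exact: order_frob_ker.
- move=> x Gx; have [Kx | K'x] := boolP (x \in K); last by rewrite sizeC // !inE eqxx !orbT.
  have [-> | nt_x] := eqVneq x 1%g; first by rewrite class1G cards1.
  by rewrite sizeK // !inE eqxx orbT.
- have /trivgPn[x Kx nt_x] : K :!=: 1%g by rewrite -cardG_gt1.
  by exists x; [exact: (subsetP sKG) | exact: sizeK].
have /subsetPn[x Gx K'x] : ~~ (G \subset K).
  by rewrite -indexg_eq1 idx neq_ltn n_gt1 orbT.
by exists x => //; exact: sizeC.
Qed.

Import GroupScope.

(** * Burnside's transfer theorem and coverings by conjugates *)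

Section Covering.

Variable gT : finGroupType.
Implicit Types G X Y P Q R : {group gT}.

(** The conjugates of X number #|G : 'N_G(X)| and all contain 1. *)
Lemma card_class_support_le G X :
  #|class_support X G|.-1 <= #|G : 'N_G(X)| * #|X|.-1.
Proof.
have -> : #|class_support X G|.-1 = #|(class_support X G)^#|.
  by rewrite [in LHS](cardsD1 1) (subsetP (sub_class_support G X)) ?group1.
have -> : #|X|.-1 = #|X^#| by rewrite [in LHS](cardsD1 1) group1.
rewrite class_supportD1 (leq_trans (leq_card_cover _)) //.
rewrite -normD1 -card_conjugates -sum_nat_const.
by apply: leq_sum => _ /imsetP[x _ ->]; rewrite cardJg.
Qed.

(** Were both subgroups proper in their normalisers, the nontrivial elements of the
conjugates of each would number at most half of #|G|, minus 1. *)
Lemma covering_self_normalising G X Y :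
    X \subset G -> Y \subset G ->
    (forall g, g \in G -> g \in class_support X G \/ g \in class_support Y G) ->
  'N_G(X) \subset X \/ 'N_G(Y) \subset Y.
Proof.
move=> sXG sYG cov.
case: (boolP ('N_G(X) \subset X)) => [|nX]; first by left.
case: (boolP ('N_G(Y) \subset Y)) => [|nY]; first by right.
have half (Z : {group gT}) : Z \subset G -> ~~ ('N_G(Z) \subset Z) ->
    (#|class_support Z G|.-1).*2 + 2 <= #|G|.
  move=> sZG nZ; have pZ : Z \proper 'N_G(Z).
    by rewrite properE nZ subsetI sZG normG.
  have dZ : #|Z| * 2 <= #|'N_G(Z)|.
    rewrite -(Lagrange (proper_sub pZ)) leq_mul2l indexg_gt1.
    by rewrite (proper_subn pZ) orbT.
  rewrite -(Lagrange (subsetIl G 'N(Z))).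
  have := card_class_support_le G Z; have := indexg_gt0 G 'N_G(Z).
  have := cardG_gt0 Z; move: dZ; move: #|_ : _| #|'N_G(Z)| #|Z| => i N z.
  by move: _.-1 => s; nia.
have h1 := half _ sXG nX; have h2 := half _ sYG nY.
have : #|G| <= (#|class_support X G|.-1 + #|class_support Y G|.-1).+1.
  have nz (Z : {group gT}) : #|class_support (gval Z) G|.-1 = #|(class_support (gval Z) G)^#|.
    by rewrite [in LHS](cardsD1 1) (subsetP (sub_class_support G Z)) ?group1.
  rewrite !nz (cardsD1 1 G) group1 add1n ltnS (leq_trans _ (leq_card_setU _ _)) //.
  apply: subset_leq_card; apply/subsetP=> g; rewrite !inE => /andP[-> /=].
  by case/cov => ->; rewrite ?orbT.
by lia.
Qed.

(** The index of the centraliser is prime to p exactly when the centraliser contains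
a Sylow p-subgroup of G. *)
Lemma class_coprimeP p G P x : p.-Sylow(G) P -> x \in G -> prime p ->
  reflect (exists2 k, k \in G & P :^ k \subset 'C[x]) (~~ (p %| #|x ^: G|)).
Proof.
move=> sylP Gx pr_p; rewrite -index_cent1; apply: (iffP idP) => [ndv | [k Gk sPC]].
  have [Q sylQ] := Sylow_exists p 'C_G[x].
  have sylQG : p.-Sylow(G) Q.
    rewrite pHallE (subset_trans (pHall_sub sylQ)) ?subsetIl //=.
    rewrite (card_Hall sylQ) -(Lagrange (subsetIl G 'C[x])) partnM //.
    by rewrite (@part_p'nat p (#|G : 'C_G[x]|)) ?muln1 ?p'natE.
  have [k Gk defQ] := Sylow_trans sylP sylQG.
  by exists k => //; rewrite -defQ (subset_trans (pHall_sub sylQ)) ?subsetIr.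
have sPkC : P :^ k \subset 'C_G[x].
  by rewrite subsetI sPC andbT conj_subG ?(pHall_sub sylP).
have sylPk : p.-Sylow(G) (P :^ k) by rewrite pHallJ.
rewrite -p'natE //; apply: pnat_dvd (_ : p^'.-nat #|G : P :^ k|).
  by rewrite -(Lagrange_index (subsetIl G 'C[x]) sPkC) dvdn_mulr.
by case/and3P: sylPk.
Qed.

(** N(P) controls fusion in the abelian group P, so elements of P that are
conjugate in G are equal, and the transfer from G to P maps g in P to g ^+ #|G : P|.  It is
injective on P, while its kernel contains the derived subgroup. *)
Lemma Burnside_transfer p G P : p.-Sylow(G) P -> 'N_G(P) \subset 'C(P) ->
  prime p -> ~~ (p %| #|G^`(1)|).
Proof.
move=> sylP sNC pr_p; have sPG := pHall_sub sylP.
have abP : abelian P by rewrite /abelian (subset_trans _ sNC) // subsetI sPG normG.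
have fusion u y : u \in P -> y \in G -> u ^ y \in P -> u ^ y = u.
  move=> Pu Gy Puy.
  have sylC (Q : {group gT}) :
      p.-Sylow(G) Q -> Q \subset 'C[u ^ y] -> p.-Sylow('C_G[u ^ y]) Q.
    move=> sylQ sQ; apply: (pHall_subl _ _ sylQ); last exact: subsetIl.
    by rewrite subsetI sQ (pHall_sub sylQ).
  have sylPy : p.-Sylow('C_G[u ^ y]) (P :^ y)%G.
    apply: sylC; first by rewrite pHallJ.
    by rewrite -cent_set1 -conjg_set1 centJ conjSg sub_abelian_cent // sub1set.
  have sylPC : p.-Sylow('C_G[u ^ y]) P.
    by apply: sylC => //; rewrite -cent_set1 sub_abelian_cent // sub1set.
  have [c /setIP[Gc /cent1P cuy] defP] := Sylow_trans sylPy sylPC.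
  have /(subsetP sNC)/centP/(_ u Pu) cyc : y * c \in 'N_G(P).
    by rewrite inE groupM //= inE conjsgM -defP.
  have : u ^ (y * c) = u by apply/conjg_fixP/commgP/commute_sym.
  by rewrite conjgM => {2}<-; apply/esym/conjg_fixP/commgP.
have abA : abelian (idm P @* P) by rewrite morphim_idm.
pose fm := restrm (transfer_morph_subproof (idm P)) (FiniteModule.fmod abA \o idm P).
have fmE g : g \in P -> fm g = FiniteModule.fmod abA g by [].
have tauE g : g \in P -> transfer G abA g = (FiniteModule.fmod abA g *+ #|G : P|)%R.
  move=> Pg; have Gg := subsetP sPG g Pg.
  have trX := transversalP (rcosets_cycle_partition sPG Gg).
  rewrite (transfer_cycle_expansion sPG abA Gg trX).
  rewrite -(sum_index_rcosets_cycle sPG Gg trX) -GRing.sumrMnr.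
  apply: eq_bigr => x Xx; rewrite -/fm.
  have Gx : x \in G := subsetP (transversal_sub trX) x Xx.
  have Pgn : g ^+ #|<[g]> : P :* x| \in P by rewrite groupX.
  have Pgx : (g ^+ #|<[g]> : P :* x|) ^ x^-1 \in P.
    have := mulg_exp_card_rcosets P g x.
    by rewrite mem_rcoset conjgE invgK mulgA.
  rewrite (fusion _ _ Pgn _ Pgx) ?groupV // fmE //.
  apply: FiniteModule.fmodX; by rewrite /= morphim_idm.
have tau0 g : g \in P -> transfer G abA g = 0%R -> g = 1.
  move=> Pg; rewrite tauE // => /(congr1 (@FiniteModule.fmval _ _ abA)).
  rewrite FiniteModule.fmvalZ FiniteModule.fmodK /=; last by rewrite morphim_idm.
  move/eqP; rewrite -order_dvdn => gn; apply/eqP; rewrite -order_eq1.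
  have : coprime #[g] #|G : P|.
    apply: (@pnat_coprime p); first exact: mem_p_elt (pHall_pgroup sylP) Pg.
    by case/and3P: sylP.
  by rewrite /coprime (gcdn_idPl gn).
pose tau := transfer_morphism G abA.
have kerG' : G^`(1) \subset 'ker tau.
  rewrite -sub_morphim_pre ?der_sub // morphimR // (commG1P _) //.
  exact: FinRing.zmod_abelian.
apply/negP=> dvp; have [g G'g og] := Cauchy pr_p dvp; have Gg := subsetP (der_sub 1 G) g G'g.
have pg : p.-group <[g]> by rewrite /pgroup -orderE og pnat_id.
have [k Gk] := Sylow_Jsub sylP (etrans (cycle_subG g G) Gg) pg.
rewrite -cycleJ cycle_subG => Pgk.
have : g ^ k \in 'ker tau.
  by rewrite (subsetP kerG') // memJ_norm // (subsetP (der_norm 1 G)).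
move/mker/(tau0 _ Pgk)/(congr1 order); rewrite orderJ og order1 => p1.
by rewrite p1 in pr_p.
Qed.
End Covering.

(** * Nonadjacent primes *)

Section NonAdjacency.
Variable gT : finGroupType.
Implicit Types G P Q R : {group gT}.

(** The case R = G serves to find an abelian quotient of G; the relative one,
to prove that R itself is abelian.  The conditions on N(P) and N(Q) make all the
G-conjugates of P and Q conjugate under R. *)
Lemma nonadjacent_covering p q G R P Q :
    prime p -> prime q -> p.-Sylow(G) P -> q.-Sylow(G) Q ->
    R \subset G -> G \subset 'N(P) * R -> G \subset 'N(Q) * R ->
    (forall x, x \in R -> ~~ (p %| #|x ^: G|) \/ ~~ (q %| #|x ^: G|)) ->
  'N_R('C_R(P)) \subset 'C(P) \/ 'N_R('C_R(Q)) \subset 'C(Q).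
Proof.
move=> pr_p pr_q sylP sylQ sRG sP sQ nadj.
have half r (S : {group gT}) x : prime r -> r.-Sylow(G) S -> G \subset 'N(S) * R ->
    x \in R -> ~~ (r %| #|x ^: G|) -> x \in class_support 'C_R(S) R.
  move=> pr_r sylS sS Rx /(class_coprimeP sylS (subsetP sRG x Rx) pr_r)[k Gk].
  have /mulsgP[n t nSn Rt ->] := subsetP sS k Gk.
  rewrite conjsgM (normP nSn) => sSC; rewrite class_supportEr; apply/bigcupP.
  exists t => //; rewrite conjIg conjGid // inE Rx -centJ.
  by apply/centP=> s /(subsetP sSC)/cent1P.
have [||x Rx|sN|sN] := @covering_self_normalising gT R 'C_R(P)%G 'C_R(Q)%G.
- exact: subsetIl.
- exact: subsetIl.
- by case: (nadj x Rx) => ndv; [left; exact: half ndv|right; exact: half ndv].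
- by left; rewrite (subset_trans sN) ?subsetIr.
by right; rewrite (subset_trans sN) ?subsetIr.
Qed.

Lemma norm_sub_norm_cent R P : 'N_R(P) \subset 'N_R('C_R(P)).
Proof.
rewrite subsetI subsetIl normsI //; first by rewrite subIset ?normG.
by rewrite norms_cent ?subsetIr.
Qed.

Lemma nonadjacent_der p q G :
    prime p -> prime q ->
    (forall x, x \in G -> ~~ (p %| #|x ^: G|) \/ ~~ (q %| #|x ^: G|)) ->
  ~~ (p %| #|G^`(1)|) \/ ~~ (q %| #|G^`(1)|).
Proof.
move=> pr_p pr_q nadj.
have [P sylP] := Sylow_exists p G; have [Q sylQ] := Sylow_exists q G.
have sG (S : {group gT}) : G \subset 'N(S) * G by rewrite mulG_subr.
have [] := nonadjacent_covering pr_p pr_q sylP sylQ (subxx _) (sG P) (sG Q) nadj.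
  move/(subset_trans (norm_sub_norm_cent G P)) => sNC.
  by left; exact: Burnside_transfer sylP sNC pr_p.
move/(subset_trans (norm_sub_norm_cent G Q)) => sNC.
by right; exact: Burnside_transfer sylQ sNC pr_q.
Qed.

(** The index of C_R(x) in R is that of C_G(x) in the product of R and C_G(x). *)
Lemma dvdn_class_normal G R x : R <| G -> #|x ^: R| %| #|x ^: G|.
Proof.
move=> nRG; have sCG := subsetIl G 'C[x].
rewrite -!index_cent1 -(dvdn_pmul2l (cardG_gt0 'C_G[x])) Lagrange //.
have sRG := normal_sub nRG; have nRC : 'C_G[x] \subset 'N(R).
  exact: subset_trans sCG (normal_norm nRG).
have -> : (#|'C_G[x]| * #|R : 'C_R[x]|)%N = #|R <*> 'C_G[x]|.
  have -> : 'C_R[x] = R :&: 'C_G[x] by rewrite setIA (setIidPl sRG).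
  apply/eqP; rewrite -(eqn_pmul2r (cardG_gt0 (R :&: 'C_G[x]))) norm_joinEr //.
  by rewrite -mul_cardG -mulnA [(#|R : _| * _)%N]mulnC Lagrange ?subsetIl // mulnC.
by rewrite cardSg // join_subG sRG.
Qed.

Lemma abelian_pcores_sub R (Y : {group gT}) : abelian R ->
  (forall p, prime p -> p %| #|R| -> 'O_p(R) \subset Y) -> R \subset Y.
Proof.
move=> /abelian_nil nilR sY; rewrite -(Sylow_gen R) gen_subG.
apply/bigcupsP=> P /SylowP[p pr_p sylP].
have [pR|p'R] := boolP (p %| #|R|).
  by rewrite (nilpotent_Hall_pcore nilR sylP) sY.
have: #|P| = 1%N by rewrite (card_Hall sylP) part_p'nat ?p'natE.
by move/card1_trivg=> ->; rewrite sub1G.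
Qed.

End NonAdjacency.

(** * The Hall subgroup prime to pi1 and pi2 is abelian *)

Section ClassSquare.
Variables (gT : finGroupType) (G : {group gT}).

Definition meets (x : gT) (X : pred nat) := exists2 p, X p & p %| #|x ^: G|.
Definition covers (x : gT) (X : pred nat) := forall p, X p -> p %| #|x ^: G|.

(** What a block square graph says about class sizes, for the sets A, B, C, D of
primes labelling pi1, pi2, pi3, pi4; the graph itself is no longer mentioned. *)
Record class_square (A B C D : pred nat) : Prop := ClassSquare {
  cs_vertex : forall p, A p || B p || C p || D p ->
    prime p /\ exists2 x, x \in G & p %| #|x ^: G|;
  cs_cover : forall p x, prime p -> x \in G -> p %| #|x ^: G| ->
    A p || B p || C p || D p;
  cs_sepAD : forall x, x \in G -> meets x A -> meets x D -> False;
  cs_sepBC : forall x, x \in G -> meets x B -> meets x C -> False;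
  cs_disj : forall p, A p + B p + C p + D p <= 1;
  cs_AB : exists x, [/\ x \in G, meets x A & meets x B];
  cs_AC : exists x, [/\ x \in G, meets x A & meets x C];
  cs_DB : exists x, [/\ x \in G, meets x D & meets x B];
  cs_DC : exists x, [/\ x \in G, meets x D & meets x C]
}.

End ClassSquare.

Lemma class_square_swap gT (G : {group gT}) A B C D :
  class_square G A B C D -> class_square G B A D C.
Proof.
case=> vx cov sAD sBC disj [x eAB] [y eAC] [z eDB] [w eDC]; split=> //.
- by move=> p Xp; apply: vx; case: (A p) (B p) (C p) (D p) Xp => [] [] [] [].
- by move=> p t pr Gt /cov-/(_ pr Gt); case: (A p) (B p) (C p) (D p) => [] [] [] [].
- by move=> p; have := disj p; case: (A p) (B p) (C p) (D p) => [] [] [] [].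
- by exists x; case: eAB.
- by exists z; case: eDB.
- by exists y; case: eAC.
by exists w; case: eDC.
Qed.

Lemma class_square_swap14 gT (G : {group gT}) A B C D :
  class_square G A B C D -> class_square G D B C A.
Proof.
case=> vx cov sAD sBC disj [x eAB] [y eAC] [z eDB] [w eDC]; split=> //.
- by move=> p Xp; apply: vx; case: (A p) (B p) (C p) (D p) Xp => [] [] [] [].
- by move=> p t pr Gt /cov-/(_ pr Gt); case: (A p) (B p) (C p) (D p) => [] [] [] [].
- by move=> t Gt tD tA; apply: sAD tA tD.
- by move=> p; have := disj p; case: (A p) (B p) (C p) (D p) => [] [] [] [].
- by exists z.
- by exists w.
- by exists x.
by exists y.
Qed.

Lemma class_square_swap23 gT (G : {group gT}) A B C D :
  class_square G A B C D -> class_square G A C B D.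
Proof.
by move/class_square_swap/class_square_swap14/class_square_swap.
Qed.

Section Core.
Variables (gT : finGroupType) (G : {group gT}) (A B C D : pred nat).
Hypothesis csq : class_square G A B C D.
Hypothesis derAB : forall p, A p || B p -> ~~ (p %| #|G^`(1)|).

Let pi : nat_pred := [pred p | A p || B p].
Let R := 'O_pi^'(G)%G.

Lemma class_prime_pi' p x : prime p -> x \in G -> p \notin pi ->
  p %| #|x ^: G| -> C p || D p.
Proof.
move=> pr_p Gx; rewrite inE /= => /norP[A'p B'p] pC.
by have := cs_cover csq pr_p Gx pC; rewrite (negPf A'p) (negPf B'p).
Qed.

Lemma der_sub_core : G^`(1) \subset R.
Proof.
apply: pcore_max (der_normal 1 G); apply/pgroupP=> p pr_p pG'.
by apply: contraL pG'; apply: derAB.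
Qed.

(** The quotient by the derived subgroup is abelian, and there the largest normal
subgroup of order prime to A and B is a Hall subgroup. *)
Lemma core_Hall : pi^'.-Hall(G) R.
Proof.
have nG' := der_normal 1 G.
have pG' : pi^'.-group G^`(1) := pgroupS der_sub_core (pcore_pgroup _ _).
have nG'R : G^`(1) <| R.
  by apply: normalS nG'; rewrite ?der_sub_core ?pcore_sub.
rewrite -(pquotient_pHall pG' nG' nG'R) /= -pquotient_pcore //.
apply: nilpotent_pcore_Hall; apply: abelian_nil; exact: sub_der1_abelian.
Qed.

Let nRG : R <| G. Proof. exact: pcore_normal. Qed.
Let sRG : R \subset G. Proof. exact: pcore_sub. Qed.

Lemma prime_core p : p %| #|R| -> prime p -> p \notin pi.
Proof. by move=> pR pr_p; have /pgroupP/(_ p pr_p pR) := pcore_pgroup pi^' G. Qed.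

(** No prime of C or D divides x, and R has no other primes that divide a class size. *)
Lemma meets_AB_cent x : x \in G -> meets G x A -> meets G x B -> R \subset 'C[x].
Proof.
move=> Gx xA xB; apply: contraT => nRC.
have : 1 < #|x ^: R| by rewrite -index_cent1 indexg_gt1 subsetI subxx.
case/pdivP=> p pr_p pR; have pG := dvdn_trans pR (dvdn_class_normal x nRG).
have pi'p : p \notin pi.
  apply: prime_core => //; apply: dvdn_trans pR _.
  by rewrite -index_cent1 dvdn_indexg.
case/orP: (class_prime_pi' pr_p Gx pi'p pG) => Xp.
  by case: (cs_sepBC csq Gx xB); exists p.
by case: (cs_sepAD csq Gx xA); exists p.
Qed.

(** The witness is the R-part of an element x given by an edge between pi1 and pi2.
The other part z of x centralises R and so is central in G: z and its conjugates
differ by elements of R, which have order prime to that of z. *)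
Lemma core_center_meets : exists r, [/\ r \in R, R \subset 'C[r], meets G r A & meets G r B].
Proof.
have [x [Gx xA xB]] := cs_AB csq; have sRC := meets_AB_cent Gx xA xB.
pose z := x.`_pi; pose r := x.`_pi^'.
have cyc y : y \in <[x]> -> R \subset 'C[y].
  move=> xy; apply: subset_trans sRC _.
  by rewrite -!cent_cycle centS // cycle_subG.
have Rr : r \in R.
  by rewrite (mem_normal_Hall core_Hall nRG) ?groupX ?p_elt_constt // groupX.
have zZ : G \subset 'C[z].
  apply/subsetP=> g Gg; apply/cent1P; apply: commute_sym; apply/commgP.
  rewrite -order_eq1.
  have Ru : [~ z, g] \in R.
    by rewrite (subsetP der_sub_core) // mem_commg // groupX.
  have zu : commute z [~ z, g].
    by apply: commute_sym; apply/cent1P; exact: (subsetP (cyc z (cycle_constt _ _))).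
  have un : [~ z, g] ^+ #[z] = 1.
    have: (z ^ g) ^+ #[z] = 1 by rewrite -(orderJ z g) expg_order.
    by rewrite conjg_mulR expgMn // expg_order mul1g.
  have: coprime #[z] #[[~ z, g]].
    apply: (@pnat_coprime pi); first exact: p_elt_constt.
    exact: mem_p_elt (pcore_pgroup _ _) Ru.
  by rewrite coprime_sym /coprime (gcdn_idPl _) // order_dvdn un.
have eqC : 'C_G[r] = 'C_G[x].
  apply/setP=> g; rewrite !in_setI; apply: andb_id2l => Gg.
  rewrite !cent1E -[in RHS](consttC pi x) -/z -/r.
  have gz : g * z = z * g by apply/cent1P; exact: (subsetP zZ).
  by rewrite mulgA gz -!mulgA (inj_eq (mulgI z)).
have eq_cl : #|r ^: G| = #|x ^: G| by rewrite -!index_cent1 eqC.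
exists r; split=> //; first by apply: cyc; exact: cycle_constt.
  by case: xA => p Ap; rewrite -eq_cl; exists p.
by case: xB => p Bp; rewrite -eq_cl; exists p.
Qed.

(** Each prime p that divides #|R| is not adjacent to a prime q of A or B that divides
r.  The element r of Z(R) normalises C_R(P), where P is a Sylow q-subgroup of G, and it
is not in C_R(P); so the covering of R yields the condition of Burnside's theorem for p. *)
Lemma core_abelian : abelian R.
Proof.
have [r [Rr sRC rA rB]] := core_center_meets.
have Gr := subsetP sRG r Rr.
suff ndv p : prime p -> ~~ (p %| #|R^`(1)|).
  apply/derG1P/card1_trivg/eqP; apply: contraT; rewrite neq_ltn ltnNge cardG_gt0 /=.
  by case/pdivP=> p pr_p; rewrite (negPf (ndv p pr_p)).
move=> pr_p; have [pR | p'R] := boolP (p %| #|R|); last first.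
  by apply: contra p'R => /dvdn_trans-> //; rewrite cardSg ?der_sub.
have pi'p := prime_core pR pr_p.
have [q [piq qr nadj]] : exists q, [/\ q \in pi, q %| #|r ^: G| & forall x, x \in G ->
    ~~ (q %| #|x ^: G|) \/ ~~ (p %| #|x ^: G|)].
  have [Cp | C'p] := boolP (C p).
    case: rB => q Bq qr; exists q; split=> //; first by rewrite inE /= Bq orbT.
    move=> x Gx; apply/orP; rewrite -negb_and; apply/negP=> /andP[qx px].
    by apply: (cs_sepBC csq Gx); [exists q | exists p].
  case: rA => q Aq qr; exists q; split=> //; first by rewrite inE /= Aq.
  move=> x Gx; apply/orP; rewrite -negb_and; apply/negP=> /andP[qx px].
  apply: (cs_sepAD csq Gx); [exists q => // | exists p => //].
  by have := class_prime_pi' pr_p Gx pi'p px; rewrite (negPf C'p).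
have pr_q : prime q.
  by have [] := cs_vertex csq (p := q); first by rewrite -orbA; move: piq; rewrite inE => ->.
have [P sylP] := Sylow_exists q G; have [Q sylQ] := Sylow_exists p R.
have sPG := pHall_sub sylP.
have sylQG : p.-Sylow(G) Q := subHall_Sylow core_Hall pi'p sylQ.
have swap (S : {group gT}) : R * 'N_G(S) \subset 'N(S) * R.
  have nSR : 'N_G(S) \subset 'N(R) := subset_trans (subsetIl _ _) (normal_norm nRG).
  by rewrite -(normC nSR) mulSg ?subsetIr.
have sGP : G \subset 'N(P) * R.
  have nRP : P \subset 'N(R) := subset_trans sPG (normal_norm nRG).
  have nRPG : R <*> P <| G.
    apply: sub_der1_normal; last by rewrite join_subG sRG.
    exact: subset_trans der_sub_core (joing_subl _ _).
  have sylPR : q.-Sylow(R <*> P) P.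
    by apply: (pHall_subl _ _ sylP); rewrite ?joing_subr ?normal_sub.
  rewrite -{1}(Frattini_arg nRPG sylPR) /= norm_joinEr // -mulgA.
  rewrite (mulSGid (_ : P \subset 'N_G(P))); last by rewrite subsetI sPG normG.
  exact: swap.
have sGQ : G \subset 'N(Q) * R.
  by rewrite -{1}(Frattini_arg nRG sylQ) swap.
have nadjR x : x \in R -> ~~ (q %| #|x ^: G|) \/ ~~ (p %| #|x ^: G|).
  by move=> Rx; apply: nadj; exact: subsetP Rx.
case: (nonadjacent_covering pr_q pr_p sylP sylQG sRG sGP sGQ nadjR) => sN.
  suff: ~~ (q %| #|r ^: G|) by rewrite qr.
  apply/(class_coprimeP sylP Gr pr_q).
  exists 1; rewrite ?conjsg1 // sub_cent1 (subsetP sN) // inE Rr.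
  apply: (subsetP (cent_sub _)); rewrite -sub_cent1.
  exact: subset_trans (subsetIl _ _) sRC.
apply: (Burnside_transfer sylQ _ pr_p).
exact: subset_trans (norm_sub_norm_cent _ _) sN.
Qed.

End Core.

(** * Class sizes in a split extension of abelian groups *)

Section Split.
Variables (gT : finGroupType) (G R H : {group gT}) (pi : nat_pred).
Hypotheses (nRG : R <| G) (hallR : pi^'.-Hall(G) R) (hallH : pi.-Hall(G) H).
Hypotheses (abR : abelian R) (abH : abelian H).

Let sRG : R \subset G. Proof. exact: normal_sub. Qed.
Let sHG : H \subset G. Proof. exact: pHall_sub hallH. Qed.

Lemma split_mul : H * R = G.
Proof.
have /sdprodP[_ <- nRH _] : R ><| H = G by apply/(sdprod_normal_pHallP nRG hallH).
by rewrite -normC.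
Qed.

Lemma sylow_complement p : p \in pi -> p.-Sylow(G) 'O_p(H).
Proof.
by move=> pip; apply: subHall_Sylow hallH pip (nilpotent_pcore_Hall _ (abelian_nil abH)).
Qed.

Lemma sylow_core p : p \notin pi -> p.-Sylow(G) 'O_p(R).
Proof.
by move=> pip; apply: subHall_Sylow hallR pip (nilpotent_pcore_Hall _ (abelian_nil abR)).
Qed.

Section Element.
Variables r h : gT.
Hypotheses (Rr : r \in R) (Hh : h \in H) (crh : commute r h).

Let Grh : r * h \in G.
Proof. by rewrite groupM ?(subsetP sRG r) ?(subsetP sHG h). Qed.

Lemma cent_core_part : 'C[r * h] \subset 'C[r].
Proof.
rewrite -!cent_cycle centS // cycle_subG.
suff {1}<- : (r * h).`_pi^' = r by exact: cycle_constt.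
rewrite consttM // constt_p_elt; last exact: mem_p_elt (pHall_pgroup hallR) Rr.
rewrite (constt1P _) ?mulg1 // p_eltNK.
exact: mem_p_elt (pHall_pgroup hallH) Hh.
Qed.

Lemma cent_complement_part : 'C[r * h] \subset 'C[h].
Proof.
rewrite -!cent_cycle centS // cycle_subG.
suff {1}<- : (r * h).`_pi = h by exact: cycle_constt.
rewrite consttM // (constt1P _) ?mul1g; last exact: mem_p_elt (pHall_pgroup hallR) Rr.
rewrite constt_p_elt //; exact: mem_p_elt (pHall_pgroup hallH) Hh.
Qed.

(** Elements of G factor as H * R, and neither factor changes whether the Sylow
subgroup of H centralises r: H normalises it and R centralises r. *)
Lemma class_dvd_complement p : prime p -> p \in pi ->
  (p %| #|(r * h) ^: G|) = ~~ ('O_p(H) \subset 'C[r]).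
Proof.
move=> pr_p pip; apply/idP/idP; apply: contraLR; rewrite ?negbK => sC.
  apply/(class_coprimeP (sylow_complement pip) Grh pr_p); exists 1 => //.
  rewrite conjsg1; apply/subsetP=> g Pg; apply/cent1P.
  apply: commuteM; first by apply/cent1P; apply: (subsetP sC).
  by apply: (centsP abH); rewrite // (subsetP (pcore_sub p H)).
have [k] := class_coprimeP (sylow_complement pip) Grh pr_p sC.
rewrite -split_mul => /mulsgP[k1 k2 Hk1 Rk2 ->]; rewrite conjsgM.
have /normP-> : k1 \in 'N('O_p(H)) by rewrite (subsetP (normal_norm (pcore_normal p H))).
move/subset_trans/(_ cent_core_part).
have rk : r ^ k2 = r by apply/conjg_fixP/commgP; apply: (centsP abR).
have rC : 'C[r] :^ k2 = 'C[r] by rewrite -cent_set1 -centJ conjg_set1 rk.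
by rewrite -{1}rC conjSg.
Qed.

(** The Sylow subgroup of R is normal in G, hence the only one. *)
Lemma class_dvd_core p : prime p -> p \notin pi ->
  (p %| #|(r * h) ^: G|) = ~~ ('O_p(R) \subset 'C[h]).
Proof.
move=> pr_p pip; apply/idP/idP; apply: contraLR; rewrite ?negbK => sC.
  apply/(class_coprimeP (sylow_core pip) Grh pr_p); exists 1 => //.
  rewrite conjsg1; apply/subsetP=> g Pg; apply/cent1P.
  apply: commuteM; last by apply/cent1P; apply: (subsetP sC).
  by apply: (centsP abR); rewrite // (subsetP (pcore_sub p R)).
have [k Gk] := class_coprimeP (sylow_core pip) Grh pr_p sC.
have /normP-> : k \in 'N('O_p(R)).
  by apply: (subsetP (normal_norm _) k Gk); apply: gFnormal_trans.
by move/subset_trans/(_ cent_complement_part).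
Qed.
End Element.

(** The part of x of order prime to R can be conjugated into H as G is solvable. *)
Lemma split_conj x : x \in G -> exists r h,
  [/\ r \in R, h \in H, commute r h & (r * h) ^: G = x ^: G].
Proof.
move=> Gx; have solG : solvable G.
  rewrite (series_sol nRG) (abelian_sol abR) /=; apply: abelian_sol.
  by rewrite /= -split_mul quotientMidr quotient_abelian.
have sxG : <[x.`_pi]> \subset G by rewrite cycle_subG groupX.
have [k Gk] := Hall_subJ solG hallH sxG (p_elt_constt pi x).
rewrite cycle_subG mem_conjg => Hz.
exists (x ^ k^-1).`_pi^', (x ^ k^-1).`_pi; split.
- by rewrite (mem_normal_Hall hallR nRG) ?p_elt_constt // groupX // groupJ ?groupV.
- by rewrite consttJ.
- by apply: commuteX2.
- by rewrite -[X in _ * X]consttNK consttC classGidl // groupV.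
Qed.

Lemma core_centralised g : g \in G -> (forall p, prime p -> p \notin pi -> 'O_p(R) \subset 'C[g]) ->
  R \subset 'C[g].
Proof.
move=> Gg sC; apply: abelian_pcores_sub => // p pr_p pR; apply: sC => //.
by have /pgroupP/(_ p pr_p pR) := pHall_pgroup hallR.
Qed.

Lemma complement_centralised g : (forall p, prime p -> p \in pi -> 'O_p(H) \subset 'C[g]) ->
  H \subset 'C[g].
Proof.
move=> sC; apply: abelian_pcores_sub => // p pr_p pR; apply: sC => //.
by have /pgroupP/(_ p pr_p pR) := pHall_pgroup hallH.
Qed.

End Split.

(** * The four class sizes *)

Section Covers.
Variables (gT : finGroupType) (G R H : {group gT}) (pi : nat_pred).
Hypotheses (nRG : R <| G) (hallR : pi^'.-Hall(G) R) (hallH : pi.-Hall(G) H).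
Hypotheses (abR : abelian R) (abH : abelian H).

Let sRG : R \subset G. Proof. exact: normal_sub. Qed.
Let sHG : H \subset G. Proof. exact: pHall_sub hallH. Qed.

Section Square.
Variables (A B C D : pred nat).
Hypothesis csq : class_square G A B C D.
Hypothesis piE : forall p, (p \in pi) = A p || B p.

Lemma vertexAB_prime p : A p || B p -> prime p.
Proof. by move=> Xp; have [] := cs_vertex csq (p := p); rewrite ?Xp. Qed.

Lemma vertexCD_prime p : C p || D p -> prime p.
Proof. by move=> Xp; have [] := cs_vertex csq (p := p); rewrite // -orbA Xp orbT. Qed.

Lemma vertexCD_notin p : C p || D p -> p \notin pi.
Proof.
by rewrite piE; have := cs_disj csq p; case: (A p) (B p) (C p) (D p) => [] [] [] [].
Qed.

Lemma split_meets x X Y : x \in G -> meets G x X -> meets G x Y ->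
  exists r h, [/\ r \in R, h \in H, commute r h, meets G (r * h) X & meets G (r * h) Y].
Proof.
move=> Gx [p Xp px] [q Yq qx].
have [r [h [Rr Hh crh eq_cl]]] := split_conj nRG hallR hallH abR abH Gx.
by exists r, h; split=> //; [exists p | exists q]; rewrite ?eq_cl.
Qed.

Lemma split_group r h : r \in R -> h \in H -> r * h \in G.
Proof. by move=> Rr Hh; rewrite groupM ?(subsetP sRG r) ?(subsetP sHG h). Qed.

Lemma meets_complement r h (X : pred nat) : r \in R -> h \in H -> commute r h ->
    (forall p, X p -> A p || B p) -> meets G (r * h) X ->
  exists2 p, X p & ~~ ('O_p(H) \subset 'C[r]).
Proof.
move=> Rr Hh crh sX [p Xp pd]; exists p => //; have ABp := sX p Xp.
by rewrite -(class_dvd_complement nRG hallR hallH abR abH Rr Hh crh) ?piE ?vertexAB_prime.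
Qed.

Lemma meets_core r h (X : pred nat) : r \in R -> h \in H -> commute r h ->
    (forall p, X p -> C p || D p) -> meets G (r * h) X ->
  exists2 p, X p & ~~ ('O_p(R) \subset 'C[h]).
Proof.
move=> Rr Hh crh sX [p Xp pd]; exists p => //; have CDp := sX p Xp.
by rewrite -(class_dvd_core nRG hallR hallH abR Rr Hh crh) ?vertexCD_notin ?vertexCD_prime.
Qed.

Lemma separated_AD r h a d : r \in R -> h \in H -> commute r h -> A a -> D d ->
  ~~ ('O_a(H) \subset 'C[r]) -> 'O_d(R) \subset 'C[h].
Proof.
move=> Rr Hh crh Aa Dd nar; apply: contraT => ndh.
have ABa : A a || B a by rewrite Aa.
have CDd : C d || D d by rewrite Dd orbT.
case: (cs_sepAD csq (split_group Rr Hh)).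
  exists a => //.
  by rewrite (class_dvd_complement nRG hallR hallH abR abH Rr Hh crh) ?piE ?vertexAB_prime.
exists d => //.
by rewrite (class_dvd_core nRG hallR hallH abR Rr Hh crh) ?vertexCD_notin ?vertexCD_prime.
Qed.

Lemma separated_BC r h b c : r \in R -> h \in H -> commute r h -> B b -> C c ->
  ~~ ('O_b(H) \subset 'C[r]) -> 'O_c(R) \subset 'C[h].
Proof.
move=> Rr Hh crh Bb Cc nbr; apply: contraT => nch.
have ABb : A b || B b by rewrite Bb orbT.
have CDc : C c || D c by rewrite Cc.
case: (cs_sepBC csq (split_group Rr Hh)).
  exists b => //.
  by rewrite (class_dvd_complement nRG hallR hallH abR abH Rr Hh crh) ?piE ?vertexAB_prime.
exists c => //.
by rewrite (class_dvd_core nRG hallR hallH abR Rr Hh crh) ?vertexCD_notin ?vertexCD_prime.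
Qed.

(** A central Sylow p-subgroup would make all class sizes prime to p. *)
Lemma complement_noncentral p : A p || B p ->
  (forall g, g \in 'O_p(H) -> R \subset 'C[g]) -> False.
Proof.
move=> ABp cR; have [|pr_p [x Gx]] := cs_vertex csq (p := p); first by rewrite ABp.
have [r [h [Rr Hh crh <-]]] := split_conj nRG hallR hallH abR abH Gx.
rewrite (class_dvd_complement nRG hallR hallH abR abH Rr Hh crh) ?piE // => /negP[].
by apply/subsetP=> g /cR/subsetP/(_ r Rr); rewrite cent1C.
Qed.

Lemma core_noncentral p : C p || D p ->
  (forall s, s \in 'O_p(R) -> H \subset 'C[s]) -> False.
Proof.
move=> CDp cH; have [|pr_p [x Gx]] := cs_vertex csq (p := p).
  by rewrite -orbA CDp orbT.
have [r [h [Rr Hh crh <-]]] := split_conj nRG hallR hallH abR abH Gx.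
rewrite (class_dvd_core nRG hallR hallH abR Rr Hh crh) ?vertexCD_notin // => /negP[].
by apply/subsetP=> s /cH/subsetP/(_ h Hh); rewrite cent1C.
Qed.

Lemma core_cent g : g \in H ->
  (forall q, C q -> 'O_q(R) \subset 'C[g]) ->
  (forall q, D q -> 'O_q(R) \subset 'C[g]) -> R \subset 'C[g].
Proof.
move=> Hg cC cD; apply: (core_centralised hallR abR (subsetP sHG g Hg)) => q pr_q pi'q.
have [/cC // | C'q] := boolP (C q); have [/cD // | D'q] := boolP (D q).
apply: contraT => nqg; have cg : commute 1 g by apply: commute_sym; exact: commute1.
have := class_dvd_core nRG hallR hallH abR (group1 R) Hg cg pr_q pi'q.
rewrite nqg => /(cs_cover csq pr_q (split_group (group1 R) Hg)).
by rewrite -piE (negPf pi'q) (negPf C'q) (negPf D'q).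
Qed.

Lemma complement_cent s :
  (forall q, A q -> 'O_q(H) \subset 'C[s]) ->
  (forall q, B q -> 'O_q(H) \subset 'C[s]) -> H \subset 'C[s].
Proof.
move=> cA cB; apply: (complement_centralised hallH abH) => q pr_q.
by rewrite piE => /orP[/cA|/cB].
Qed.

Let sH p g : g \in 'O_p(H) -> g \in H. Proof. exact: subsetP (pcore_sub p H) g. Qed.
Let sR p s : s \in 'O_p(R) -> s \in R. Proof. exact: subsetP (pcore_sub p R) s. Qed.

(** Take r from an edge between pi1 and pi2.  An element of H that commutes with
r must centralise the Sylow subgroups of R for C and for D, hence it is central. *)
Lemma covered_AB : exists x, [/\ x \in G, covers G x A & covers G x B].
Proof.
have [x [Gx xA xB]] := cs_AB csq.
have [r [h [Rr Hh crh]]] := split_meets Gx xA xB.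
case/(meets_complement Rr Hh crh) => [p -> //|a Aa na].
case/(meets_complement Rr Hh crh) => [p ->|b Bb nb]; first by rewrite orbT.
suff cov p : A p || B p -> p %| #|(r * 1) ^: G|.
  by exists (r * 1); split=> [|p Xp|p Xp]; rewrite ?split_group ?cov ?Xp ?orbT.
move=> ABp; have c1 : commute r 1 := commute1 r.
rewrite (class_dvd_complement nRG hallR hallH abR abH Rr (group1 H) c1) ?piE ?vertexAB_prime //.
apply/negP=> /subsetP cP; apply: (complement_noncentral ABp) => g Pg.
have crg : commute r g by apply/commute_sym/cent1P; exact: cP.
apply: (core_cent (sH Pg)) => q Xq; first exact: (separated_BC Rr (sH Pg) crg Bb).
exact: (separated_AD Rr (sH Pg) crg Aa).
Qed.

(** Dual to the previous argument, with the roles of R and H exchanged. *)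
Lemma covered_DC : exists x, [/\ x \in G, covers G x D & covers G x C].
Proof.
have [x [Gx xD xC]] := cs_DC csq.
have [r [h [Rr Hh crh]]] := split_meets Gx xD xC.
case/(meets_core Rr Hh crh) => [p ->|d Dd nd]; first by rewrite orbT.
case/(meets_core Rr Hh crh) => [p ->//|c Cc nc].
suff cov p : C p || D p -> p %| #|(1 * h) ^: G|.
  by exists (1 * h); split=> [|p Xp|p Xp]; rewrite ?split_group ?cov ?Xp ?orbT.
move=> CDp; have c1 : commute 1 h by apply: commute_sym; exact: commute1.
rewrite (class_dvd_core nRG hallR hallH abR (group1 R) Hh c1) ?vertexCD_notin ?vertexCD_prime //.
apply/negP=> /subsetP cP; apply: (core_noncentral CDp) => s Ps.
have csh : commute s h by apply/cent1P; exact: cP.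
apply: complement_cent => q Xq; apply: contraT => nq.
  by rewrite (separated_AD (sR Ps) Hh csh Xq Dd nq) in nd.
by rewrite (separated_BC (sR Ps) Hh csh Xq Cc nq) in nc.
Qed.

Lemma AC_elements : exists r h, [/\ r \in R, h \in H, commute r h,
    exists2 a, A a & ~~ ('O_a(H) \subset 'C[r])
  & exists2 c, C c & ~~ ('O_c(R) \subset 'C[h])].
Proof.
have [x [Gx xA xC]] := cs_AC csq.
have [r [h [Rr Hh crh]]] := split_meets Gx xA xC.
case/(meets_complement Rr Hh crh) => [p -> //|a Aa na].
case/(meets_core Rr Hh crh) => [p ->//|c Cc nc].
by exists r, h; split=> //; [exists a | exists c].
Qed.

(** An edge between pi1 and pi3 gives commuting r and h such that h centralises the
Sylow d-subgroup of R, while any s in R commuting with h is centralised by the Sylow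
b-subgroup of H. *)
Lemma commuting_BD b d s : B b -> D d -> s \in 'O_d(R) -> 'O_b(H) \subset 'C[s].
Proof.
move=> Bb Dd Ps; have [r [h [Rr Hh crh [a Aa na] [c Cc nc]]]] := AC_elements.
have csh : commute s h.
  by apply/cent1P; apply: subsetP Ps; exact: (separated_AD Rr Hh crh Aa Dd na).
by apply: contraR nc => /(separated_BC (sR Ps) Hh csh Bb Cc).
Qed.
End Square.

(** The edge between pi4 and pi2 shows that the Sylow subgroups of H for A and of R
for C commute.  So an element of the former that commutes with r is central, and so is an
element of the latter that commutes with h. *)
Lemma covered_AC A B C D : class_square G A B C D ->
    (forall p, (p \in pi) = A p || B p) ->
  exists x, [/\ x \in G, covers G x A & covers G x C].
Proof.
move=> csq piE; have csq' := class_square_swap csq.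
have piE' p : (p \in pi) = B p || A p by rewrite piE orbC.
have [r [h [Rr Hh crh [a Aa na] [c Cc nc]]]] := AC_elements csq piE.
exists (r * h); split=> [|p Ap|p Cp]; first exact: split_group.
  have ABp : A p || B p by rewrite Ap.
  rewrite (class_dvd_complement nRG hallR hallH abR abH Rr Hh crh) ?piE ?(vertexAB_prime csq) //.
  apply/negP=> /subsetP cP; apply: (complement_noncentral csq piE ABp) => g Pg.
  have Hg : g \in H := subsetP (pcore_sub p H) g Pg.
  have crg : commute r g by apply/commute_sym/cent1P; exact: cP.
  apply: (core_cent csq piE Hg) => q Xq; last exact: (separated_AD csq piE Rr Hg crg Aa).
  apply/subsetP=> s Qs; rewrite cent1C.
  exact: (subsetP (commuting_BD csq' piE' Ap Xq Qs)).
have CDp : C p || D p by rewrite Cp.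
rewrite (class_dvd_core nRG hallR hallH abR Rr Hh crh) ?(vertexCD_notin csq piE) ?(vertexCD_prime csq) //.
apply/negP=> /subsetP cP; apply: (core_noncentral csq piE CDp) => s Ps.
have Rs : s \in R := subsetP (pcore_sub p R) s Ps.
have csh : commute s h by apply/cent1P; exact: cP.
apply: (complement_cent piE) => q Xq; first exact: (commuting_BD csq' piE' Xq Cp Ps).
by apply: contraR nc => /(separated_BC csq piE Rs Hh csh Xq Cc).
Qed.
End Covers.

Definition square_covered (gT : finGroupType) (G : {group gT}) (A B C D : pred nat) :=
  [/\ exists x, [/\ x \in G, covers G x A & covers G x B],
      exists x, [/\ x \in G, covers G x A & covers G x C],
      exists x, [/\ x \in G, covers G x D & covers G x B]
    & exists x, [/\ x \in G, covers G x D & covers G x C]].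

Lemma class_square_covered_der gT (G : {group gT}) A B C D :
    class_square G A B C D ->
    (forall p, A p || B p -> ~~ (p %| #|G^`(1)|)) ->
  square_covered G A B C D.
Proof.
move=> csq derAB; pose pi : nat_pred := [pred p | A p || B p].
have nRG : 'O_pi^'(G) <| G := pcore_normal _ _.
have hallR := core_Hall derAB; have abR := core_abelian csq derAB.
have sG'R := der_sub_core derAB.
have solG : solvable G.
  by rewrite (series_sol nRG) !abelian_sol //= sub_der1_abelian.
have [H hallH] := Hall_exists pi solG.
have abH : abelian H.
  apply/derG1P/trivgP; have := coprime_TIg (_ : coprime #|'O_pi^'(G)| #|H|).
  move=> <-; last first.
    by rewrite coprime_sym (pnat_coprime (pHall_pgroup hallH) (pcore_pgroup _ _)).
  by rewrite subsetI der_sub (subset_trans (dergS 1 (pHall_sub hallH)) sG'R).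
have piE p : (p \in pi) = A p || B p by [].
have piE' p : (p \in pi) = B p || A p by rewrite piE orbC.
split.
- exact: (covered_AB nRG hallR hallH abR abH csq piE).
- exact: (covered_AC nRG hallR hallH abR abH csq piE).
- have [x [Gx xB xD]] := covered_AC nRG hallR hallH abR abH (class_square_swap csq) piE'.
  by exists x.
exact: (covered_DC nRG hallR hallH abR abH csq piE).
Qed.

(** * Block square class graphs are complete between blocks *)

Lemma square_covered_swap14 gT (G : {group gT}) A B C D :
  square_covered G D B C A -> square_covered G A B C D.
Proof. by case. Qed.

Lemma square_covered_swap23 gT (G : {group gT}) A B C D :
  square_covered G A C B D -> square_covered G A B C D.
Proof. by case. Qed.

(** If some a in A divides #|G^`(1)| then no d in D does, as a and d are not adjacent. *)
Lemma class_square_der gT (G : {group gT}) A B C D : class_square G A B C D ->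
  (forall p, A p -> ~~ (p %| #|G^`(1)|)) \/ (forall p, D p -> ~~ (p %| #|G^`(1)|)).
Proof.
move=> csq; have [/hasP[a] | nA] := boolP (has A (primes #|G^`(1)|)).
  rewrite mem_primes => /and3P[pr_a _ aG'] Aa; right=> d Dd.
  have [pr_d _] : prime d /\ exists2 x, x \in G & d %| #|x ^: G|.
    by apply: (cs_vertex csq); rewrite Dd orbT.
  have [x Gx||//] := @nonadjacent_der _ a d G pr_a pr_d.
    apply/orP; rewrite -negb_and; apply/negP=> /andP[ax dx].
    by apply: (cs_sepAD csq Gx); [exists a | exists d].
  by rewrite aG'.
left=> p Ap; apply: contra nA => pG'; apply/hasP; exists p => //.
rewrite mem_primes cardG_gt0 pG' !andbT.
by have [] := cs_vertex csq (p := p); rewrite ?Ap.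
Qed.

(** Exchanging pi1 with pi4, or pi2 with pi3, arranges that the primes of A and of B
do not divide #|G^`(1)|. *)
Theorem class_square_covered gT (G : {group gT}) A B C D :
  class_square G A B C D -> square_covered G A B C D.
Proof.
wlog dA : A D / forall p, A p -> ~~ (p %| #|G^`(1)|).
  move=> th csq; case: (class_square_der csq) => [dA | dD]; first exact: th.
  by apply/square_covered_swap14/th => //; exact: class_square_swap14.
wlog dB : B C / forall p, B p -> ~~ (p %| #|G^`(1)|).
  move=> th csq.
  case: (class_square_der (class_square_swap csq)) => [dB | dC]; first exact: th.
  by apply/square_covered_swap23/th => //; exact: class_square_swap23.
move=> csq; apply: class_square_covered_der => // p /orP[]; first exact: dA.
exact: dB.
Qed.

Lemma divides_class_sizeP (gT : finGroupType) (G : {group gT}) n :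
  reflect (exists2 x, x \in G & n %| #|x ^: G|) (divides_class_size G n).
Proof.
apply: (iffP existsP) => [[_ /andP[/imsetP[x Gx ->] dv]] | [x Gx dv]]; first by exists x.
by exists (x ^: G); rewrite dv mem_classes.
Qed.

(** An isomorphism from e to the class graph of G, presented by the primes assigned
to the vertices of e. *)
Record class_labelling (T : finType) (e : rel T) (gT : finGroupType) (G : {group gT})
    (psi : T -> nat) : Prop := ClassLabelling {
  cl_inj : injective psi;
  cl_vertex : forall t, class_prime G (psi t);
  cl_onto : forall p, class_prime G p -> exists t, psi t == p;
  cl_edge : forall s t, e s t = (s != t) && divides_class_size G (psi s * psi t)
}.

Lemma graph_iso_labelling (T : finType) (e : rel T) gT (G : {group gT}) :
  graph_iso (@class_graph gT G) e <-> exists psi, class_labelling e G psi.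
Proof.
split=> [[f [g fK gK] fe] | [psi [inj vx onto edge]]].
  exists (fun t => sval (g t)); split=> [s t /val_inj eq_g | t | p pr_p | s t].
  - exact: can_inj gK _ _ eq_g.
  - exact: (svalP (g t)).
  - by exists (f (exist _ p pr_p)); rewrite fK.
  rewrite -{1}[s]gK -{1}[t]gK fe /class_graph.
  by rewrite (inj_eq val_inj) (inj_eq (can_inj gK)).
have ex (v : class_graph_vertex G) : exists t, psi t == sval v.
  by apply: onto; exact: svalP v.
pose f v := xchoose (ex v); have fP v : psi (f v) = sval v by apply/eqP/(xchooseP (ex v)).
exists f.
  exists (fun t => exist _ (psi t) (vx t)) => [v | t].
    by apply: val_inj; rewrite /= fP.
  by apply: inj; rewrite fP.
by move=> u v; rewrite edge /class_graph !fP -!fP (inj_eq inj).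
Qed.

Section Necessity.
Variables (T : finType) (e : rel T) (pi1 pi2 pi3 pi4 : {set T}).
Hypothesis bsq : block_square e pi1 pi2 pi3 pi4.
Variables (gT : finGroupType) (G : {group gT}) (psi : T -> nat).
Hypothesis lab : class_labelling e G psi.

Definition labels (X : {set T}) : pred nat := [pred p | [exists t in X, psi t == p]].

Lemma labelsE X t : labels X (psi t) = (t \in X).
Proof.
apply/existsP/idP=> [[s /andP[Xs /eqP/(cl_inj lab)<-]] // | Xt].
by exists t; rewrite Xt eqxx.
Qed.

Lemma labelsP X p : labels X p -> exists2 t, t \in X & p = psi t.
Proof. by case/existsP=> t /andP[Xt /eqP<-]; exists t. Qed.

Lemma label_prime t : prime (psi t).
Proof. by have /andP[] := cl_vertex lab t. Qed.

Lemma labels_coprime s t : s != t -> coprime (psi s) (psi t).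
Proof.
move=> neq; rewrite prime_coprime ?label_prime // dvdn_prime2 ?label_prime //.
by rewrite (inj_eq (cl_inj lab)).
Qed.

Lemma edge_meets X Y : some_adjacent e X Y ->
  exists x, [/\ x \in G, meets G x (labels X) & meets G x (labels Y)].
Proof.
case=> s [t [Xs Yt]]; rewrite (cl_edge lab) => /andP[_ /divides_class_sizeP[x Gx dv]].
exists x; split=> //; [exists (psi s) | exists (psi t)]; rewrite ?labelsE //.
  exact: dvdn_trans (dvdn_mulr _ (dvdnn _)) dv.
exact: dvdn_trans (dvdn_mull _ (dvdnn _)) dv.
Qed.

Lemma nonadjacent_separated (X Y : {set T}) : [disjoint X & Y] -> none_adjacent e X Y ->
  forall x, x \in G -> meets G x (labels X) -> meets G x (labels Y) -> False.
Proof.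
move=> dXY nadj x Gx [_ /labelsP[s Xs ->] sx] [_ /labelsP[t Yt ->] tx].
have neq : s != t.
  by apply: contraTneq Yt => <-; rewrite (disjointFr dXY).
case/negP: (nadj s t Xs Yt); rewrite (cl_edge lab) neq /=.
apply/divides_class_sizeP; exists x => //.
by rewrite Gauss_dvd ?sx ?labels_coprime.
Qed.

Lemma covers_edge x X Y s t : x \in G -> covers G x (labels X) -> covers G x (labels Y) ->
  s \in X -> t \in Y -> s != t -> e s t.
Proof.
move=> Gx cX cY Xs Yt neq; rewrite (cl_edge lab) neq /=.
apply/divides_class_sizeP; exists x => //.
by rewrite Gauss_dvd ?labels_coprime // cX ?cY ?labelsE.
Qed.

Lemma labels_class_square :
  class_square G (labels pi1) (labels pi2) (labels pi3) (labels pi4).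
Proof.
case: bsq => cover _ [d12 d13 d14] [d23 d24 d34] n14 n23 [e12 e13] [e42 e43].
have labU t : [|| labels pi1 (psi t), labels pi2 (psi t), labels pi3 (psi t) | labels pi4 (psi t)].
  have := in_setT t; rewrite -cover !labelsE !inE -!orbA; exact.
split; try exact: edge_meets; try exact: nonadjacent_separated.
- move=> p lp; have [t ->] : exists t, p = psi t.
    by move: lp; rewrite -!orbA => /or4P[] /labelsP[t _ ->]; exists t.
  have /andP[-> /divides_class_sizeP[x Gx dv]] := cl_vertex lab t; split=> //; by exists x.
- move=> p x pr_p Gx px; have [|t /eqP<-] := cl_onto lab (p := p).
    by rewrite /class_prime pr_p; apply/divides_class_sizeP; exists x.
  by rewrite -!orbA labU.
move=> p; have [/existsP[t /eqP<-]|] := boolP [exists t, psi t == p].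
  rewrite !labelsE.
  case: (boolP (t \in pi1)) => [t1|_]; first by rewrite (disjointFr d12) ?(disjointFr d13) ?(disjointFr d14).
  case: (boolP (t \in pi2)) => [t1|_]; first by rewrite (disjointFr d23) ?(disjointFr d24).
  case: (boolP (t \in pi3)) => [t1|_]; first by rewrite (disjointFr d34).
  by case: (t \in pi4).
move/existsPn=> np; have lF X : labels X p = false.
  by apply/negbTE/negP=> /labelsP[t _ ep]; have := np t; rewrite ep eqxx.
by rewrite !lF.
Qed.

Lemma block_square_complete :
  [/\ clique e pi1, clique e pi2, clique e pi3 & clique e pi4]
  /\ all_adjacent e (pi1 :|: pi4) (pi2 :|: pi3).
Proof.
have [[x [Gx xA xB]] [y [Gy yA yC]] [z [Gz zD zB]] [w [Gw wD wC]]] :=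
  class_square_covered labels_class_square.
split.
  split=> s t Xs Xt neq.
  - exact: (covers_edge Gx xA xA Xs Xt neq).
  - exact: (covers_edge Gx xB xB Xs Xt neq).
  - exact: (covers_edge Gy yC yC Xs Xt neq).
  exact: (covers_edge Gz zD zD Xs Xt neq).
case: bsq => _ _ [d12 d13 d14] [d23 d24 d34] _ _ _ _.
have neq (X Y : {set T}) s t : [disjoint X & Y] -> s \in X -> t \in Y -> s != t.
  by move=> dXY Xs; apply: contraTneq => <-; rewrite (disjointFr dXY Xs).
rewrite disjoint_sym in d24; rewrite disjoint_sym in d34.
move=> s t /setUP[] Xs /setUP[] Xt.
- exact: (covers_edge Gx xA xB Xs Xt (neq _ _ _ _ d12 Xs Xt)).
- exact: (covers_edge Gy yA yC Xs Xt (neq _ _ _ _ d13 Xs Xt)).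
- exact: (covers_edge Gz zD zB Xs Xt (neq _ _ _ _ d24 Xs Xt)).
exact: (covers_edge Gw wD wC Xs Xt (neq _ _ _ _ d34 Xs Xt)).
Qed.
End Necessity.

(** * A group for each complete block square *)

Lemma class_setX (gT1 gT2 : finGroupType) (G1 : {group gT1}) (G2 : {group gT2}) x y :
  (x, y) ^: setX G1 G2 = setX (x ^: G1) (y ^: G2).
Proof.
apply/setP=> -[u v]; rewrite in_setX; apply/imsetP/andP=> [[[g h]] | []].
  by rewrite in_setX => /andP[Gg Gh] [-> ->]; rewrite !memJ_class.
case/imsetP=> g Gg -> /imsetP[h Gh ->]; exists (g, h) => //.
by rewrite in_setX Gg.
Qed.

Fixpoint prime_seq k : nat :=
  if k is k'.+1 then s2val (prime_above (prime_seq k')) else 2.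

Lemma prime_seq_prime k : prime (prime_seq k).
Proof. by case: k => //= k; case: prime_above. Qed.

Lemma prime_seq_inj : injective prime_seq.
Proof.
have lt k : prime_seq k < prime_seq k.+1 by rewrite /=; case: prime_above.
have mono : {homo prime_seq : i j / i < j} := homo_ltn ltn_trans lt.
move=> i j eq_ij; case: (ltngtP i j) => // /mono; rewrite eq_ij ltnn //.
Qed.

Section Sufficiency.
Variables (T : finType) (e : rel T) (pi1 pi2 pi3 pi4 : {set T}).
Hypotheses (e_sym : symmetric e) (e_irr : irreflexive e).
Hypothesis bsq : block_square e pi1 pi2 pi3 pi4.
Hypotheses (cl1 : clique e pi1) (cl2 : clique e pi2).
Hypotheses (cl3 : clique e pi3) (cl4 : clique e pi4).
Hypothesis full : all_adjacent e (pi1 :|: pi4) (pi2 :|: pi3).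

Let psi (t : T) := prime_seq (enum_rank t).
Let block (X : {set T}) := (\prod_(t in X) psi t)%N.

Let psi_prime t : prime (psi t). Proof. exact: prime_seq_prime. Qed.
Let psi_inj : injective psi.
Proof. by move=> s t /prime_seq_inj/ord_inj/enum_rank_inj. Qed.

Lemma prime_dvd_block p (X : {set T}) : prime p ->
  reflect (exists2 t, t \in X & p = psi t) (p %| block X).
Proof.
move=> pr_p; apply: (iffP idP) => [|[t Xt ->]]; last first.
  by rewrite /block (bigD1 t) //= dvdn_mulr.
rewrite /block; elim/big_rec: _ => [|t n Xt IH].
  by rewrite dvdn1 => /eqP p1; rewrite p1 in pr_p.
rewrite Euclid_dvdM // => /orP[|/IH //].
by rewrite dvdn_prime2 // => /eqP->; exists t.
Qed.

Lemma psi_dvd_block t (X : {set T}) : (psi t %| block X) = (t \in X).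
Proof.
apply/prime_dvd_block/idP=> // [[s Xs /psi_inj-> //] | Xt].
by exists t.
Qed.

Lemma block_gt1 (X : {set T}) : X != set0 -> 1 < block X.
Proof.
case/set0Pn=> t Xt; rewrite (leq_trans (prime_gt1 (psi_prime t))) //.
rewrite dvdn_leq ?psi_dvd_block //; apply: prodn_gt0 => s; exact: prime_gt0.
Qed.

Lemma block_coprime (X Y : {set T}) : [disjoint X & Y] -> coprime (block X) (block Y).
Proof.
move=> dXY; rewrite coprime_has_primes; last 2 first.
- by apply: prodn_gt0 => s; exact: prime_gt0.
- by apply: prodn_gt0 => s; exact: prime_gt0.
apply/hasPn=> p; rewrite mem_primes => /and3P[pr_p _ /(prime_dvd_block _ pr_p)[t Yt ->]].
by rewrite mem_primes psi_dvd_block (disjointFl dXY Yt) !andbF.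
Qed.

Lemma adjacent_in_cover X Y s t : clique e X -> clique e Y -> all_adjacent e X Y ->
  s \in X :|: Y -> t \in X :|: Y -> s != t -> e s t.
Proof.
move=> clX clY XY /setUP[] Xs /setUP[] Xt neq.
- exact: clX.
- exact: XY.
- by rewrite e_sym; exact: XY.
exact: clY.
Qed.

(** Only for the nonadjacent pairs pi1, pi4 and pi2, pi3 is there no such union that
contains both blocks. *)
Lemma edge_in_cover s t : e s t || (s == t) -> exists X Y,
  [/\ X = pi1 \/ X = pi4, Y = pi2 \/ Y = pi3, s \in X :|: Y & t \in X :|: Y].
Proof.
case: bsq => cover _ [_ _ d14] [d23 _ _] n14 n23 _ _ st.
have inU u : [|| u \in pi1, u \in pi2, u \in pi3 | u \in pi4].
  by have := in_setT u; rewrite -cover !inE -!orbA.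
have sep (X Y : {set T}) u v : none_adjacent e X Y -> [disjoint X & Y] -> e u v || (u == v) ->
    u \in X -> v \in Y -> False.
  move=> nXY dXY uv Xu Yv; case/orP: uv => [| /eqP eq_uv].
    by rewrite (negPf (nXY u v Xu Yv)).
  by rewrite -eq_uv (disjointFr dXY Xu) in Yv.
have ts : e t s || (t == s) by rewrite e_sym eq_sym.
case/or4P: (inU s) => Xs; case/or4P: (inU t) => Xt;
  try by [case: (sep _ _ s t n14 d14 st Xs Xt) | case: (sep _ _ t s n14 d14 ts Xt Xs)
         | case: (sep _ _ s t n23 d23 st Xs Xt) | case: (sep _ _ t s n23 d23 ts Xt Xs)].
all: by first [exists pi1, pi2; split; [left | left | |]; by rewrite // inE ?Xs ?Xt ?orbT
  | exists pi1, pi3; split; [left | right | |]; by rewrite // inE ?Xs ?Xt ?orbT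
  | exists pi4, pi2; split; [right | left | |]; by rewrite // inE ?Xs ?Xt ?orbT
  | exists pi4, pi3; split; [right | right | |]; by rewrite // inE ?Xs ?Xt ?orbT].
Qed.

Lemma block_square_labelling : exists (gT : finGroupType) (G : {group gT}),
  class_labelling e G psi.
Proof.
case: (bsq) => cover [n1 n2 n3 n4] [d12 d13 d14] [d23 d24 d34] n14 n23 _ _.
have sizes (X Y : {set T}) : X != set0 -> Y != set0 -> [disjoint X & Y] ->
    exists (gT : finGroupType) (G : {group gT}),
    (forall x, x \in G -> exists2 Z, Z = X \/ Z = Y &
      forall p, prime p -> p %| #|x ^: G| -> p %| block Z)
    /\ (forall Z, Z = X \/ Z = Y -> exists2 x, x \in G &
      forall t, t \in Z -> psi t %| #|x ^: G|).
  move=> nX nY dXY.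
  have [gT [G [k [dk sz [x Gx sx] [y Gy sy]]]]] :=
    frobenius_sizes (block_gt1 nX) (block_gt1 nY) (block_coprime dXY).
  exists gT, G; split=> [z Gz | Z [] ->].
  - have := sz z Gz; rewrite !inE => /or3P[] /eqP->.
    + by exists X; [left | move=> p pr_p; rewrite dvdn1 => /eqP p1; rewrite p1 in pr_p].
    + by exists X; first by left.
    by exists Y => [|p pr_p]; [right | rewrite dk].
  - by exists x => // t Xt; rewrite sx psi_dvd_block.
  by exists y => // t Yt; rewrite sy dk // psi_dvd_block.
have [gT1 [G1 [sub1 real1]]] := sizes _ _ n1 n4 d14.
have [gT2 [G2 [sub2 real2]]] := sizes _ _ n2 n3 d23.
pose G := setX_group G1 G2.
have cardG x y : #|(x, y) ^: G| = (#|x ^: G1| * #|y ^: G2|)%N by rewrite class_setX cardsX.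
have sub z : z \in G -> exists X Y, [/\ X = pi1 \/ X = pi4, Y = pi2 \/ Y = pi3 &
    forall p, prime p -> p %| #|z ^: G| -> exists2 t, t \in X :|: Y & p = psi t].
  case: z => x y; rewrite in_setX => /andP[/sub1[X X14 sX] /sub2[Y Y23 sY]].
  exists X, Y; split=> // p pr_p; rewrite cardG Euclid_dvdM // => /orP[/sX|/sY] pd.
    by have /(prime_dvd_block _ pr_p)[t Xt ->] := pd pr_p; exists t; rewrite // inE Xt.
  by have /(prime_dvd_block _ pr_p)[t Xt ->] := pd pr_p; exists t; rewrite // inE Xt orbT.
have real X Y : X = pi1 \/ X = pi4 -> Y = pi2 \/ Y = pi3 -> exists2 z, z \in G &
    forall t, t \in X :|: Y -> psi t %| #|z ^: G|.
  move=> /real1[x G1x xX] /real2[y G2y yY]; exists (x, y); first by rewrite in_setX G1x.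
  by move=> t /setUP[/xX|/yY] dt; rewrite cardG; [apply: dvdn_mulr | apply: dvdn_mull].
exists _, G; split=> // [t | p /andP[pr_p /divides_class_sizeP[z Gz pz]] | s t].
- rewrite /class_prime psi_prime; apply/divides_class_sizeP.
  have [|X [Y [X14 Y23 Xt _]]] := @edge_in_cover t t; first by rewrite eqxx orbT.
  by have [z Gz dz] := real X Y X14 Y23; exists z; last exact: dz.
- by have [X [Y [_ _ sXY]]] := sub z Gz; have [t _ ->] := sXY p pr_p pz; exists t.
have co : s != t -> coprime (psi s) (psi t).
  by move=> neq; rewrite prime_coprime // dvdn_prime2 // (inj_eq psi_inj).
apply/idP/andP=> [st | [neq /divides_class_sizeP[z Gz]]].
  have neq : s != t by apply: contraTneq st => ->; rewrite e_irr.
  split=> //; have [|X [Y [X14 Y23 Xs Xt]]] := @edge_in_cover s t; first by rewrite st.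
  have [z Gz dz] := real X Y X14 Y23; apply/divides_class_sizeP; exists z => //.
  by rewrite Gauss_dvd ?co // !dz.
rewrite Gauss_dvd ?co // => /andP[sz tz].
have [X [Y [X14 Y23 sXY]]] := sub z Gz.
have [s' Xs /psi_inj eq_s] := sXY _ (psi_prime s) sz.
have [t' Xt /psi_inj eq_t] := sXY _ (psi_prime t) tz.
rewrite eq_s eq_t in neq *; apply: (@adjacent_in_cover X Y) => //.
- by case: X14 => ->.
- by case: Y23 => ->.
by move=> u v Xu Yv; apply: full; rewrite inE; [case: X14 => <- | case: Y23 => <-];
  rewrite ?Xu ?Yv ?orbT.
Qed.

End Sufficiency.

Theorem corollaryB (T : finType) (e : rel T)
    (e_sym : symmetric e) (e_irr : irreflexive e)
    (pi1 pi2 pi3 pi4 : {set T})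
    (bsq : block_square e pi1 pi2 pi3 pi4) :
  (exists (gT : finGroupType) (G : {group gT}),
      graph_iso (@class_graph gT G) e)
  <->
  [/\ clique e pi1, clique e pi2, clique e pi3 & clique e pi4]
  /\ all_adjacent e (pi1 :|: pi4) (pi2 :|: pi3).
Proof.
split=> [[gT [G /graph_iso_labelling[psi lab]]] | [[cl1 cl2 cl3 cl4] full]].
  exact: block_square_complete bsq gT G psi lab.
have [gT [G lab]] := block_square_labelling e_sym e_irr bsq cl1 cl2 cl3 cl4 full.
by exists gT, G; apply/graph_iso_labelling; eexists; exact: lab.
Qed.
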